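(* For every integer $m\ge 1$ and every parameter vector $\mathsf{Param}$ with $\deg(\mathsf{Param})\le 12$, $$\dim_{\mathbb F_2}(Q^{\otimes m})^{\mathsf{Param}}\le\prod_{1\le j\le m}(2^j-1).$$
   Context: $\mathscr A$ is the mod-2 Steenrod algebra and $\overline{\mathscr A}$ its positive-degree part. $\mathcal P_m=\mathbb F_2[x_1,\ldots,x_m]$, $|x_i|=1$, is an $\mathscr A$-module via $Sq^k(x_j^n)=\binom nk x_j^{n+k}$ and the Cartan formula. For $n\ge0$ write $n=\sum_{t\ge0}\alpha_t(n)2^t$ in binary. The parameter vector of a monomial $X=x_1^{u_1}\cdots x_m^{u_m}$ is $\mathsf{Param}(X)=(\mathsf{Param}_1(X),\mathsf{Param}_2(X),\ldots)$ with $\mathsf{Param}_i(X)=\sum_{1\le j\le m}\alpha_{i-1}(u_j)$. In general a parameter vector is a sequence $\mathsf{Param}=(\mathsf{Param}_1,\mathsf{Param}_2,\ldots)$ of non-negative integers with $\mathsf{Param}_i=0$ for $i\gg0$; its degree is $\deg(\mathsf{Param})=\sum_{i\ge1}2^{i-1}\mathsf{Param}_i$. Parameter vectors are ordered left-lexicographically. $\mathcal P_m^{\le\mathsf{Param}}$ (resp. $\mathcal P_m^{<\mathsf{Param}}$) is the span of monomials $X$ of degree $\deg(\mathsf{Param})$ with $\mathsf{Param}(X)\le\mathsf{Param}$ (resp. $<$). For $F,G\in\mathcal P_m^{\le\mathsf{Param}}$, $F\sim_{\mathsf{Param}}G$ means $F+G\in\overline{\mathscr A}\mathcal P_m+\mathcal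 P_m^{<\mathsf{Param}}$; $(Q^{\otimes m})^{\mathsf{Param}}$ is the quotient of $\mathcal P_m^{\le\mathsf{Param}}$ by $\sim_{\mathsf{Param}}$, i.e. $\mathcal P_m^{\le\mathsf{Param}}/\big((\overline{\mathscr A}\mathcal P_m\cap\mathcal P_m^{\le\mathsf{Param}})+\mathcal P_m^{<\mathsf{Param}}\big)$. *)

(* Defs.v *)
From HB Require Import structures.
From mathcomp Require Import all_boot all_order all_algebra.
From mathcomp Require Import generic_quotient ring_quotient.
From mathcomp Require Import finmap boolp mpoly zify.
Set Implicit Arguments. Unset Strict Implicit. Unset Printing Implicit Defensive.
Import GRing.Theory.
Local Open Scope ring_scope.

(* The quotient vT / W, with projection qpi: the quotient group of
   ring_quotient with its induced scaling. *)
Section QuotientSpace.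
Variables (F : fieldType) (vT : vectType F) (W : {vspace vT}).

Definition quotv : Type := Quotient.quot W.
HB.instance Definition _ := GRing.Zmodule.on quotv.

Definition qpi (v : vT) : quotv := \pi_(Quotient.quot W)%qT v.

Lemma qpi_eq u v : (qpi u == qpi v) = (u - v \in W).
Proof. by rewrite /qpi -Quotient.idealrBE. Qed.

Definition qrepr (x : quotv) : vT := repr (x : Quotient.quot W).

Lemma qpi_repr : cancel qrepr qpi.
Proof. exact: reprK. Qed.

Lemma qpiD u v : qpi (u + v) = qpi u + qpi v.
Proof. exact: (raddfD (\pi_(Quotient.quot W)%qT)). Qed.

Definition scale_quotv (a : F) (x : quotv) : quotv := qpi (a *: qrepr x).

Lemma qpiZ a v : qpi (a *: v) = scale_quotv a (qpi v).
Proof.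
by apply/eqP; rewrite qpi_eq -scalerBr memvZ // -qpi_eq qpi_repr.
Qed.

Fact scale_quotvA a b x :
  scale_quotv a (scale_quotv b x) = scale_quotv (a * b) x.
Proof. by rewrite -(qpi_repr x) -!qpiZ scalerA. Qed.

Fact scale_quotv1 : left_id 1 scale_quotv.
Proof. by move=> x; rewrite -{1}(qpi_repr x) -qpiZ scale1r qpi_repr. Qed.

Fact scale_quotvDr : right_distributive scale_quotv +%R.
Proof.
move=> a x y; rewrite -(qpi_repr x) -(qpi_repr y) -qpiD -!qpiZ.
by rewrite scalerDr qpiD.
Qed.

Fact scale_quotvDl x : {morph scale_quotv^~ x : a b / a + b}.
Proof. by move=> a b; rewrite -(qpi_repr x) -!qpiZ scalerDl qpiD. Qed.

HB.instance Definition _ := GRing.Zmodule_isLmodule.Build F quotv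
  scale_quotvA scale_quotv1 scale_quotvDr scale_quotvDl.

Fact qpi_is_linear : linear qpi.
Proof. by move=> a u v; rewrite qpiD qpiZ. Qed.
HB.instance Definition _ :=
  GRing.isLinear.Build F vT quotv _ qpi qpi_is_linear.

Fact quotv_vect_iso : Vector.axiom (\dim W^C) quotv.
Proof.
pose f := daddv_pi W^C W.
have CW0 : (W^C :&: W = 0)%VS by rewrite capvC capv_compl.
have memfB v : v - f v \in W.
  have := daddv_pi_add (w := v) CW0; rewrite addvC addv_complf memvf => /(_ isT).
  by move=> e; rewrite -[X in X - _]e addrC addKr memv_pi.
have feq u v : u - v \in W -> f u = f v.
  move=> uvW; apply/eqP; rewrite -subr_eq0 -linearB -memv0 -CW0 memv_cap memv_pi.
  by rewrite -[X in X \in W](subKr (u - v)) rpredB.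
have fC v : v \in W^C%VS -> f v = v by apply: daddv_pi_id.
exists (fun x : quotv => \row_i coord (vbasis W^C) i (f (qrepr x))).
  move=> a x y; apply/rowP=> i; rewrite !mxE -linearP -linearP.
  by congr (coord _ _ _); apply: feq; rewrite -qpi_eq qpi_repr qpi_is_linear !qpi_repr.
exists (fun r : 'rV_(\dim W^C) => qpi (\sum_i r 0 i *: (vbasis W^C)`_i)).
  move=> x /=; rewrite -[RHS]qpi_repr; apply/eqP; rewrite qpi_eq -opprB memvN.
  rewrite (eq_bigr (fun i => coord (vbasis W^C) i (f (qrepr x)) *: (vbasis W^C)`_i)).
    by rewrite -coord_vbasis ?memv_pi ?memfB.
  by move=> i _; rewrite mxE.
move=> r; apply/rowP=> i; rewrite mxE.
set s := \sum_(i < _) _; have sC : s \in W^C%VS.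
  by apply: rpred_sum => j _; rewrite rpredZ ?vbasis_mem ?memt_nth.
rewrite (feq _ s) ?fC // ?coord_sum_free ?(basis_free (vbasisP _)) //.
by rewrite -qpi_eq qpi_repr.
Qed.

HB.instance Definition _ := Lmodule_hasFinDim.Build F quotv quotv_vect_iso.

Lemma dim_quotv : \dim {: quotv} = (\dim {: vT} - \dim W)%N.
Proof. by rewrite dimvf /dim /= dimv_compl. Qed.

End QuotientSpace.

Section Steenrod.
Variable m : nat.
Local Notation P := {mpoly 'F_2[m]}.

(* Sq^k on a monomial x^u: iterating the Cartan formula and
   Sq^i (x_j^n) = 'C(n, i) x_j^(n+i) gives the sum over all ways v of
   distributing k over the variables. sq is its linear extension; sq_Xn and
   sq_cartan recover the two defining rules. *)
Definition sqX (k : nat) (u : 'X_{1..m}) : P :=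
  \sum_(v : {ffun 'I_m -> 'I_k.+1} | (\sum_j v j)%N == k)
     \prod_(j < m) ('C(u j, v j)%:R * 'X_j ^+ (u j + v j)).

Definition sq (k : nat) (f : P) : P :=
  \sum_(u <- msupp f) f@_u *: sqX k u.

(* Total square x_j |-> x_j + x_j^2 t, with t = 'X. *)
Let tot_h (j : 'I_m) : {poly P} := ('X_j)%:P + ('X_j ^+ 2)%:P * 'X.
Let tot : P -> {poly P} := mmap (polyC \o @mpolyC m 'F_2) tot_h.

Let coef_prod_ffun (k : nat) (p : 'I_m -> {poly P}) :
  (\prod_j p j)`_k =
  \sum_(v : {ffun 'I_m -> 'I_k.+1} | (\sum_j v j)%N == k) \prod_j (p j)`_(v j).
Proof.
pose q j := \sum_(i < k.+1) (p j)`_i *: 'X^i.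
have [s ->] : exists s, \prod_j p j = \prod_j q j + 'X^(k.+1) * s.
  elim/big_rec2: _ => [|j a b _ [s ->]]; first by exists 0; rewrite mulr0 addr0.
  have -> : p j = q j + 'X^(k.+1) * drop_poly k.+1 (p j).
    rewrite -{1}(poly_take_drop k.+1 (p j)) [_ * 'X^_]mulrC.
    by rewrite /q /take_poly poly_def.
  exists (q j * s + drop_poly k.+1 (p j) * (a + 'X^(k.+1) * s)).
  set d := drop_poly _ _; set X := 'X^_.
  by rewrite mulrDl !mulrDr -!addrA !mulrA [q j * X]mulrC.
rewrite coefD coefXnM ltnSn addr0 bigA_distr_bigA /= coef_sum [RHS]big_mkcond.
apply: eq_bigr => v _.
under eq_bigr => j _ do rewrite -mul_polyC.
rewrite big_split /= -rmorph_prod -expr_sum coefCM coefXn eq_sym.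
by case: eqP; rewrite ?mulr1 ?mulr0.
Qed.

Let tot_hX j n i :
  (tot_h j ^+ n)`_i = 'C(n, i)%:R * 'X_j ^+ (n + i).
Proof.
have -> : tot_h j ^+ n =
    \poly_(i < n.+1) ('C(n, i)%:R * 'X_j ^+ (n + i)).
  rewrite exprDn poly_def; apply: eq_bigr => -[l /=]; rewrite ltnS => ln _.
  rewrite exprMn -!polyC_exp mulrA -polyCM mul_polyC scalerMnl -exprM -exprD.
  by rewrite mulr_natl; congr ((_ ^+ _ *+ _) *: _); lia.
by rewrite coef_poly ltnS; case: leqP => // /bin_small ->; rewrite mul0r.
Qed.

Lemma sqX_tot k u : sqX k u = (mmap1 tot_h u)`_k.
Proof.
rewrite coef_prod_ffun; apply: eq_bigr => v _; apply: eq_bigr => j _.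
by rewrite tot_hX.
Qed.

Lemma sq_tot k f : sq k f = (tot f)`_k.
Proof.
rewrite /tot /mmap coef_sum; apply: eq_bigr => u _.
by rewrite /= coefCM mul_mpolyC sqX_tot.
Qed.

Lemma sq_is_linear k : linear (sq k).
Proof.
move=> a f g; rewrite !sq_tot /tot mmapD coefD; congr (_ + _).
by rewrite mmapZ /= coefCM mul_mpolyC.
Qed.

HB.instance Definition _ k :=
  GRing.isLinear.Build 'F_2 P P _ (sq k) (sq_is_linear k).

Lemma sq_Xn k j n : sq k ('X_j ^+ n) = 'C(n, k)%:R * 'X_j ^+ (n + k).
Proof.
by rewrite sq_tot /tot rmorphXn /= mmapX mmap1U tot_hX.
Qed.

Lemma sq_cartan k f g : sq k (f * g) = \sum_(i < k.+1) sq i f * sq (k - i) g.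
Proof.
rewrite sq_tot /tot rmorphM coefM; apply: eq_bigr => i _.
by rewrite !sq_tot.
Qed.
End Steenrod.

(* A finite-dimensional F_2-vector space is finite, so an arbitrary set S of
   vectors is cut out of an enumeration of the whole space; span_of S is the
   linear span of S. *)
Definition span_of (vT : vectType 'F_2) (S : vT -> Prop) : {vspace vT} :=
  <<[seq v <- codom (@VectorInternalTheory.r2v _ vT) | `[< S v >]]>>%VS.

Lemma mem_span_of (vT : vectType 'F_2) (S : vT -> Prop) (v : vT) :
  S v -> v \in span_of S.
Proof.
move=> Sv; apply: memv_span; rewrite mem_filter; apply/andP; split.
  exact/asboolP.
by rewrite -(VectorInternalTheory.v2rK v) codom_f.
Qed.

Lemma span_of_sub (vT : vectType 'F_2) (S : vT -> Prop) (U : {vspace vT}) :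
  (forall v, S v -> v \in U) -> (span_of S <= U)%VS.
Proof.
by move=> SU; apply/span_subvP => v; rewrite mem_filter => /andP[/asboolP /SU].
Qed.

Lemma span_of_closed (vT : vectType 'F_2) (S : vT -> Prop) :
  S 0 -> (forall u v, S u -> S v -> S (u + v)) ->
  forall v, v \in span_of S <-> S v.
Proof.
move=> S0 SD v; split; last exact: mem_span_of.
rewrite /span_of; set s := [seq _ <- _ | _].
rewrite -[s]in_tupleE => /coord_span ->.
apply: (big_ind S) => // i _.
have : s`_i \in s by rewrite mem_nth.
rewrite mem_filter => /andP[/asboolP Si _] /=.
by case: (coord _ _ _) => -[|[|//]] ci; [rewrite (_ : Ordinal _ = 0) ?scale0r |
   rewrite (_ : Ordinal _ = 1) ?scale1r]; rewrite ?in_tupleE //; apply: val_inj.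
Qed.

Section ParameterVectors.

(* Indices start at 0: p i is the (i+1)-st entry of the parameter vector. *)
Definition pvec := {fsfun nat -> nat with 0%N}.

Definition pdeg (p : pvec) : nat := (\sum_(i <- finsupp p) 2 ^ i * p i)%N.

Definition lt_pvec (p q : pvec) : Prop :=
  exists2 i, (forall j, (j < i)%N -> p j = q j) & (p i < q i)%N.

Definition le_pvec (p q : pvec) : Prop := p = q \/ lt_pvec p q.

Definition bdigit (t n : nat) : nat := (n %/ 2 ^ t %% 2)%N.

(* All binary digits of the exponents of X at positions >= mdeg X vanish, so
   this truncation loses nothing; see mparamE. *)
Definition mparam (m : nat) (X : 'X_{1..m}) : pvec :=
  [fsfun i in [fset i in iota 0 (mdeg X)]%fset => (\sum_(j < m) bdigit i (X j))%N].

Lemma mparamE m (X : 'X_{1..m}) i :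
  mparam X i = (\sum_(j < m) bdigit i (X j))%N.
Proof.
rewrite fsfunE !inE mem_iota /=; case: ltnP => // dXi.
apply/esym/big1 => j _; rewrite /bdigit divn_small ?mod0n //.
apply: leq_ltn_trans (ltn_expl _ (ltnSn 1)); apply: leq_trans dXi.
by rewrite mdegE (bigD1 j) //= leq_addr.
Qed.

End ParameterVectors.

Section Hit.
Variable m : nat.
Local Notation P := {mpoly 'F_2[m]}.

(* The action of Sq^{k_1} ... Sq^{k_r}, for I = [:: k_1; ...; k_r]. *)
Definition sqs (I : seq nat) (f : P) : P := foldr (@sq m) f I.

(* Membership in the product of the positive-degree part of the Steenrod
   algebra with P. The algebra is generated by the Sq^k, so its positive-degree
   part is spanned by the words Sq^I with sum of I positive (Sq^0 acts as the
   identity); the scalars are absorbed in the polynomials. *)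
Definition hit (f : P) : Prop :=
  exists2 s : seq (seq nat * P),
    {in s, forall x, 0 < sumn x.1}%N & f = \sum_(x <- s) sqs x.1 x.2.

Lemma hit0 : hit 0.
Proof. by exists [::]; rewrite ?big_nil. Qed.

Lemma hitD f g : hit f -> hit g -> hit (f + g).
Proof.
move=> [s s_gt0 ->] [t t_gt0 ->]; exists (s ++ t); last by rewrite big_cat.
by move=> x; rewrite mem_cat => /orP[/s_gt0|/t_gt0].
Qed.
End Hit.

(* The number of variables is n.+1. All spaces live in the space V of
   homogeneous polynomials of degree pdeg p, so the monomials X below have
   degree pdeg p. *)
Section QParam.
Variables (n : nat) (p : pvec).
Local Notation V := (dhomog n.+1 'F_2 (pdeg p)).

Definition Ple : {vspace V} :=
  span_of (fun F => exists2 X, le_pvec (mparam X) p & mpoly_of_dhomog F = 'X_[X]).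
Definition Plt : {vspace V} :=
  span_of (fun F => exists2 X, lt_pvec (mparam X) p & mpoly_of_dhomog F = 'X_[X]).
(* The hit polynomials of degree pdeg p; see mem_hitv. *)
Definition hitv : {vspace V} := span_of (fun F => hit (mpoly_of_dhomog F)).

Lemma mem_hitv (F : V) : F \in hitv <-> hit (mpoly_of_dhomog F).
Proof.
apply: (span_of_closed (S := fun F : V => hit (mpoly_of_dhomog F))).
  by rewrite raddf0; apply: hit0.
by move=> u v hu hv; rewrite raddfD; apply: hitD.
Qed.

Lemma Plt_sub : (Plt <= Ple)%VS.
Proof.
apply: span_of_sub => v [X ltX vX]; apply: mem_span_of; exists X => //.
by right.
Qed.

Definition Prel : {vspace V} := ((hitv :&: Ple) + Plt)%VS.

Definition Qparam : vectType 'F_2 :=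
  quotv (linfun (vsval : subvs_of Ple -> V) @^-1: Prel)%VS.

Lemma Prel_sub : (Prel <= Ple)%VS.
Proof. by rewrite subv_add capvSr Plt_sub. Qed.

(* Two elements have the same class iff they are related by ~_Param. *)
Lemma Qparam_simP (F G : subvs_of Ple) :
  (qpi _ F : Qparam) = qpi _ G <-> vsval F + vsval G \in (hitv + Plt)%VS.
Proof.
have opp2 (v : V) : - v = v.
  by rewrite -scaleN1r (_ : -1 = 1) ?scale1r //; apply: val_inj.
have -> : (qpi _ F : Qparam) = qpi _ G <-> vsval F + vsval G \in Prel.
  rewrite -[vsval G]opp2 -linearB -(lfunE vsval) memv_preim -qpi_eq.
  by split=> /eqP.
split=> [/memv_addP[h /memv_capP[hH _] [l lP ->]]|]; first exact: memv_add.
move=> /memv_addP[h hH [l lP FGE]]; rewrite FGE memv_add // memv_cap hH /=.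
have -> : h = vsval F + vsval G - l by rewrite FGE addrK.
by rewrite rpredB ?rpredD ?subvsP // (subvP Plt_sub).
Qed.

Lemma dim_Qparam : \dim {: Qparam} = (\dim Ple - \dim Prel)%N.
Proof.
rewrite dim_quotv dimvf /dim /=; congr (_ - _)%N.
set f := linfun _.
have f_inj : lker f = 0%VS.
  by apply/eqP/lker0P => u v; rewrite !lfunE; apply: val_inj.
have PrelE : (f @: (f @^-1: Prel))%VS = Prel.
  apply: lpreimK; apply/subvP => v /(subvP Prel_sub) vP.
  by rewrite -(vsprojK vP) -(lfunE vsval) memv_img ?memvf.
by rewrite -[LHS](limg_ker_dim f) PrelE f_inj capv0 dimv0.
Qed.
End QParam.

(* Main.v *)
(** A monomial of [P_m] with parameter vector [p] is given by one subset of
    size [p_i] of the variables for each binary position [i], so the dimension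
    is at most the product of the binomials [C(m, p_i)]. In degree at most 12
    there are only four positions, and this product exceeds the claimed bound
    only for [m = 2] and [m = 3], at finitely many parameter vectors. For these
    one uses hit equations [Sq^(2^i) f] with [f] a monomial: whenever all the
    terms of such an equation but one are already known to lie in the span of
    hit polynomials, lower monomials and a chosen set [B] of monomials, so does
    the remaining one. This closure process, started from a suitable [B] of at
    most 3, resp. 21, monomials, reaches every monomial of parameter vector [p]. *)
Require Import Defs.
From mathcomp Require Import all_boot all_order all_algebra.
From mathcomp Require Import finmap mpoly zify.
Local Open Scope nat_scope.
Set Implicit Arguments. Unset Strict Implicit. Unset Printing Implicit Defensive.
Import GRing.Theory.

(** * Exponent sequences and the terms of Steenrod squares of monomials *)

Fixpoint compositions (m e : nat) : seq (seq nat) :=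
  if m is m'.+1 then
    flatten [seq map (cons i) (compositions m' (e - i)) | i <- iota 0 e.+1]
  else if e == 0 then [:: [::]] else [::].

Lemma compositionsS m e : compositions m.+1 e =
  flatten [seq map (cons i) (compositions m (e - i)) | i <- iota 0 e.+1].
Proof. by []. Qed.

Lemma mem_compositions m e us :
  (us \in compositions m e) = (size us == m) && (sumn us == e).
Proof.
elim: m e us => [|m IHm] e us; first by case: e us => [|e] [|u us].
rewrite compositionsS.
apply/flatten_mapP/idP => [[i]|].
  rewrite mem_iota /= add0n ltnS => ie /mapP[vs].
  rewrite IHm => /andP[/eqP <- /eqP vE] ->.
  by rewrite /= vE subnKC // !eqxx.
case: us => [|u us] //; rewrite eqSS => /andP[us_m /eqP /= usE].
have ue : u \in iota 0 e.+1 by rewrite mem_iota; lia.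
exists u => //.
by apply: map_f; rewrite IHm us_m; apply/eqP; lia.
Qed.

(* The exponent sequences of the terms of Sq^k(x^us), by the Cartan formula. *)
Fixpoint sqmon (k : nat) (us : seq nat) : seq (seq nat) :=
  if us is u :: us' then
    flatten [seq map (cons (u + i)) (sqmon (k - i) us')
            | i <- iota 0 k.+1 & odd 'C(u, i)]
  else if k == 0 then [:: [::]] else [::].

Lemma sqmon_cons k u us : sqmon k (u :: us) =
  flatten [seq map (cons (u + i)) (sqmon (k - i) us)
          | i <- iota 0 k.+1 & odd 'C(u, i)].
Proof. by []. Qed.

Lemma sqmon_compositions k us vs :
  vs \in sqmon k us -> vs \in compositions (size us) (sumn us + k).
Proof.
rewrite mem_compositions.
elim: us k vs => [|u us IHus] k vs.
  by case: k => [|k] //=; rewrite inE => /eqP ->.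
rewrite sqmon_cons.
move=> /flatten_mapP[i]; rewrite mem_filter mem_iota /= add0n ltnS => /andP[_ ik].
move=> /mapP[ws /IHus/andP[/eqP szw /eqP sw] ->].
by rewrite /= szw sw eqxx; apply/eqP; lia.
Qed.

Definition mon m (us : seq nat) : 'X_{1..m} := [multinom nth 0 us j | j < m].

Section Monomials.
Variable m : nat.
Implicit Types us : seq nat.

Local Notation prodX js us :=
  (\prod_(x <- zip js us) 'X_x.1 ^+ x.2 : {mpoly 'F_2[m]})%R.

Lemma natr_F2 c : (c%:R = (odd c)%:R :> {mpoly 'F_2[m]})%R.
Proof.
rewrite -[c in LHS]odd_double_half natrD -muln2 natrM.
suff -> : (2%:R = 0 :> {mpoly 'F_2[m]})%R by rewrite mulr0 addr0.
rewrite -[LHS](rmorph_nat (@mpolyC m 'F_2)) (_ : 2%:R = 0)%R ?rmorph0 //.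
exact: val_inj.
Qed.

(** A distribution with some [v j > 0] contributes the factor ['C(0, v j) = 0], so a term survives
    only for [k = 0]. *)
Lemma sq1 k : sq k (1 : {mpoly 'F_2[m]})%R = ((k == 0)%:R)%R.
Proof.
rewrite -[X in sq k X]mpolyX0 /sq msuppX big_seq1 mcoeffX eqxx scale1r /sqX.
case: k => [|k] /=.
  rewrite (bigD1 [ffun=> ord0]) /=; last by rewrite big1 // => j _; rewrite ffunE.
  rewrite [X in (_ + X)%R]big1 ?addr0; last first.
    move=> v /andP[_]; case/eqP; apply/ffunP => j; rewrite ffunE.
    by apply: val_inj; case: (v j) => -[].
  by rewrite big1 // => j _; rewrite ffunE mnm0E bin0 expr0 mulr1.
apply: big1 => v /eqP vk.
have [j vj] : exists j, 0 < v j.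
  apply/existsP; apply: contraPT vk => /existsPn v0.
  by rewrite big1 // => j _; apply/eqP; rewrite -leqn0 leqNgt.
by rewrite (bigD1 j) //= mnm0E bin_small // !mul0r.
Qed.

(** Induction on the variables: the Cartan formula splits off the first one, and over F_2 its
    binomial coefficient only matters through its parity, which is the filter in [sqmon]. The list
    [js] is arbitrary because a tail of [enum 'I_m] is no longer an enumeration. *)
Lemma sq_prodX k (js : seq 'I_m) us : size js = size us ->
  (sq k (prodX js us) = \sum_(vs <- sqmon k us) prodX js vs)%R.
Proof.
elim: us js k => [|u us IHus] [|j js] k //.
  move=> _; rewrite big_nil sq1; case: k => [|k] /=; rewrite ?big_nil //.
  by rewrite big_seq1 big_nil.
case=> szj; rewrite big_cons sq_cartan sqmon_cons big_flatten big_map big_filter.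
rewrite -[k.+1 in RHS]subn0 -/(index_iota 0 k.+1) big_mkcond big_mkord /=.
apply: eq_bigr => i _; rewrite sq_Xn natr_F2 IHus // big_map.
case: odd; rewrite ?mul0r // mul1r mulr_sumr.
by apply: eq_bigr => vs _; rewrite big_cons.
Qed.

Lemma mpolyX_mon us : size us = m -> ('X_[mon m us] = prodX (enum 'I_m) us)%R.
Proof.
move=> szus; rewrite mpolyXE_id.
have usE : us = [seq nth 0 us (j : 'I_m) | j <- enum 'I_m].
  rewrite (map_comp (nth 0 us) val) /= val_enum_ord -szus.
  by rewrite -/(mkseq _ _) mkseq_nth.
rewrite [in RHS]usE -[X in zip X _]map_id zip_map big_map big_enum /=.
by apply: eq_bigr => j _; rewrite mnmE.
Qed.

Lemma sq_mon k us : size us = m ->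
  (sq k 'X_[mon m us] = \sum_(vs <- sqmon k us) 'X_[mon m vs] :> {mpoly 'F_2[m]})%R.
Proof.
move=> szus; rewrite mpolyX_mon // sq_prodX ?size_enum_ord //.
apply: eq_big_seq => vs /sqmon_compositions; rewrite mem_compositions.
by case/andP=> /eqP szv _; rewrite mpolyX_mon // szv.
Qed.

Lemma sum_ord_nth (f : nat -> nat) us : size us = m ->
  \sum_(j < m) f (nth 0 us j) = sumn (map f us).
Proof. by move=> <-; rewrite sumnE big_map (big_nth 0) big_mkord. Qed.

Lemma mdeg_mon us : size us = m -> mdeg (mon m us) = sumn us.
Proof.
move=> szus; rewrite mdegE -[us in RHS]map_id -(sum_ord_nth id) //.
by apply: eq_bigr => j _; rewrite mnmE.
Qed.

Lemma mparam_mon us i : size us = m ->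
  mparam (mon m us) i = sumn (map (bdigit i) us).
Proof.
move=> szus; rewrite mparamE -sum_ord_nth //.
by apply: eq_bigr => j _; rewrite mnmE.
Qed.

Lemma mon_surj (X : 'X_{1..m}) : exists2 us, size us = m & X = mon m us.
Proof.
exists (map X (enum 'I_m)); first by rewrite size_map size_enum_ord.
by apply/mnmP => j; rewrite mnmE (nth_map j) ?size_enum_ord ?nth_ord_enum.
Qed.

End Monomials.

(** * Spanning by monomials modulo hit and lower polynomials *)

Section Bound.
Variables (n : nat) (p : pvec).
Local Notation V := (dhomog n.+1 'F_2 (pdeg p)).
Implicit Types (s : seq 'X_{1..n.+1}) (f g : {mpoly 'F_2[n.+1]}).

(** The condition [mparam X = p] keeps this span inside [Ple], as [dim_Qparam_le] requires. *)
Definition span_mons s : {vspace V} :=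
  span_of (fun F => exists2 X, (X \in s) /\ mparam X = p & mpoly_of_dhomog F = 'X_[X]).

(** Stated for plain polynomials, with homogeneity carried by the witness, so that sums of monomials
    need no repackaging in [V]. *)
Definition spanned s f := exists2 F : V,
  F \in (hitv n p + Plt n p + span_mons s)%VS & mpoly_of_dhomog F = f.

Lemma spanned0 s : spanned s 0%R.
Proof. by exists 0%R; rewrite ?rpred0 ?raddf0. Qed.

Lemma spannedD s f g : spanned s f -> spanned s g -> spanned s (f + g)%R.
Proof. by move=> [F FU <-] [G GU <-]; exists (F + G)%R; rewrite ?rpredD ?raddfD. Qed.

Lemma spannedN s f : spanned s f -> spanned s (- f)%R.
Proof. by move=> [F FU <-]; exists (- F)%R; rewrite ?rpredN ?raddfN. Qed.

Lemma spanned_hit s f : f \is (pdeg p).-homog -> hit f -> spanned s f.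
Proof.
move=> fd hf; exists (DHomog fd) => //.
by rewrite -addvA; apply/(subvP (addvSl _ _))/mem_hitv.
Qed.

Lemma spanned_lt s X :
  mdeg X = pdeg p -> lt_pvec (mparam X) p -> spanned s 'X_[X]%R.
Proof.
move=> /eqP Xd ltX; rewrite -(dhomogX 'F_2) in Xd; exists (DHomog Xd) => //.
apply/(subvP (addvSl _ _))/(subvP (addvSr _ _)).
by apply: mem_span_of; exists X.
Qed.

Lemma spanned_mem s X :
  mdeg X = pdeg p -> mparam X = p -> X \in s -> spanned s 'X_[X]%R.
Proof.
move=> /eqP Xd eX Xs; rewrite -(dhomogX 'F_2) in Xd; exists (DHomog Xd) => //.
by apply/(subvP (addvSr _ _))/mem_span_of; exists X.
Qed.

Lemma dim_span_mons s : \dim (span_mons s) <= size s.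
Proof.
pose t := [seq insubd (0%R : V) 'X_[X]%R | X <- s].
rewrite -(size_map (fun X => insubd (0%R : V) 'X_[X]%R) s).
apply: leq_trans (dim_span t); apply/dimvS/span_of_sub => F [X [Xs _] FX].
by apply/memv_span/mapP; exists X; rewrite // -FX valKd.
Qed.

(** The hypothesis yields [Ple] inside [Prel + span_mons s]; comparing dimensions gives the
    bound. *)
Lemma dim_Qparam_le s :
  (forall X, mdeg X = pdeg p -> mparam X = p -> spanned s 'X_[X]%R) ->
  \dim {: Qparam n p} <= size s.
Proof.
move=> sP; rewrite dim_Qparam leq_subLR.
apply: leq_trans (leq_add (leqnn _) (dim_span_mons s)).
apply: leq_trans (dimv_add_leqif _ _).1; apply/dimvS/span_of_sub => F [X leX FX].
have Xd : mdeg X = pdeg p.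
  by apply/eqP; rewrite -(dhomogX 'F_2) -FX; apply: dhomog_is_dhomog.
case: leX => [eX | ltX]; last first.
  apply/(subvP (addvSl _ _))/(subvP (addvSr _ _)).
  by apply: mem_span_of; exists X.
have [F' F'U F'X] := sP X Xd eX.
have {F' F'U F'X} /memv_addP[v /memv_addP[h hH [l lP ->]] [b bB FE]] :
    F \in (hitv n p + Plt n p + span_mons s)%VS.
  by rewrite (_ : F = F') //; apply: val_inj; rewrite /= FX.
rewrite FE memv_add // memv_add // memv_cap hH /=.
(* Modular law: [F], [l] and [b] all lie in [Ple], hence so does the hit part [h], as [Prel]
   demands. *)
have -> : h = (F - l - b)%R by rewrite FE addrAC !addrK.
rewrite !rpredB //.
- by apply: mem_span_of; exists X => //; left.
- exact: (subvP (Plt_sub _ _)).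
- apply: (subvP _ _ bB); apply: span_of_sub => G [Y [_ eY] GY].
  by apply: mem_span_of; exists Y => //; left.
Qed.

End Bound.

(** * Binary digits of exponents and the binomial bound *)

Lemma sum_bdigit K u : u < 2 ^ K -> \sum_(i < K) 2 ^ i * bdigit i u = u.
Proof.
elim: K u => [|K IHK] u uK; first by rewrite big_ord0; case: u uK.
rewrite big_ord_recl [bdigit _ u]/bdigit divn1 mul1n.
rewrite (eq_bigr (fun i : 'I_K => 2 * (2 ^ i * bdigit i (u %/ 2)))); last first.
  by move=> i _; rewrite /bdigit /= expnS -mulnA -divnMA.
rewrite -big_distrr /= IHK; first by rewrite addnC mulnC -divn_eq.
by rewrite ltn_divLR // mulnC -expnS.
Qed.

Lemma mnm_leq_mdeg m (X : 'X_{1..m}) j : X j <= mdeg X.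
Proof. by rewrite mdegE (bigD1 j) //= leq_addr. Qed.

Lemma mparam_eq0 m (X : 'X_{1..m}) K i :
  mdeg X < 2 ^ K -> K <= i -> mparam X i = 0.
Proof.
move=> XK Ki; rewrite mparamE big1 // => j _; rewrite /bdigit divn_small ?mod0n //.
apply: leq_ltn_trans (mnm_leq_mdeg X j) _.
by apply: leq_trans XK _; rewrite leq_exp2l.
Qed.

Section SmallDegree.
Variables (p : pvec) (K : nat).
Hypothesis pK : pdeg p < 2 ^ K.

Lemma pvec_eq0 i : K <= i -> p i = 0.
Proof.
move=> Ki; apply/eqP/contraT; rewrite -mem_finsupp => ip.
have : 2 ^ i <= pdeg p.
  rewrite /pdeg (big_rem i ip) /=; apply: leq_trans (leq_addr _ _).
  by rewrite leq_pmulr // lt0n -mem_finsupp.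
by rewrite leqNgt (leq_trans pK) // leq_exp2l.
Qed.

Lemma pdeg_sum : pdeg p = \sum_(i < K) 2 ^ i * p i.
Proof.
rewrite /pdeg (perm_big [seq i <- iota 0 K | i \in finsupp p]) /=; last first.
  apply: uniq_perm => [||i]; rewrite ?fset_uniq ?filter_uniq ?iota_uniq //.
  rewrite mem_filter mem_iota /=; case: (boolP (i \in finsupp p)) => //=.
  by rewrite mem_finsupp add0n; case: ltnP => // /pvec_eq0->.
rewrite big_filter -[K in iota 0 K]subn0 big_mkcond big_mkord.
apply: eq_bigr => i _; case: ifPn => //.
by rewrite mem_finsupp negbK => /eqP->; rewrite muln0.
Qed.

Lemma mparam_eq m (X : 'X_{1..m}) : mdeg X = pdeg p ->
  (forall i, i < K -> mparam X i = p i) -> mparam X = p.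
Proof.
move=> Xd eqK; apply/fsfunP => i; case: (ltnP i K) => [/eqK // | Ki].
by rewrite pvec_eq0 // (mparam_eq0 (K := K)) // Xd.
Qed.

Lemma dim_Qparam_bin n : \dim {: Qparam n p} <= \prod_(i < K) 'C(n.+1, p i).
Proof.
(* [f i] is the set of variables whose exponent has binary digit 1 at position [i]; [mk] reassembles
   the exponents. *)
pose mk (f : {ffun 'I_K -> {set 'I_n.+1}}) : 'X_{1..n.+1} :=
  [multinom \sum_(i < K) 2 ^ i * (j \in f i) | j < n.+1].
pose F (i : 'I_K) := [pred A : {set 'I_n.+1} | #|A| == p i].
have -> : \prod_(i < K) 'C(n.+1, p i) = size [seq mk f | f in family F].
  rewrite size_image card_family foldrE big_image /=; apply: eq_bigr => i _.
  by rewrite -[n.+1 in LHS]card_ord -card_draws cardsE.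
apply: dim_Qparam_le => X Xd Xp; apply: spanned_mem => //.
have dig j i : bdigit i (X j) = (bdigit i (X j) == 1) :> nat.
  by rewrite /bdigit modn2; case: odd.
apply/imageP; exists [ffun i : 'I_K => [set j | bdigit i (X j) == 1]].
  apply/familyP => i; rewrite ffunE inE -Xp mparamE -sum1_card big_mkcond /=.
  by apply/eqP/eq_bigr => j _; rewrite inE [RHS]dig; case: eqP.
apply/mnmP => j; rewrite mnmE -[LHS](@sum_bdigit K); last first.
  by apply: leq_ltn_trans (mnm_leq_mdeg X j) _; rewrite Xd.
by apply: eq_bigr => i _; rewrite ffunE inE {1}dig.
Qed.

End SmallDegree.

(** * The closure process as a computation *)

Definition digits K us := mkseq (fun i => sumn (map (bdigit i) us)) K.

Fixpoint lexlt (v w : seq nat) :=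
  if v is x :: v' then
    if w is y :: w' then (x < y) || (x == y) && lexlt v' w' else false
  else false.

Definition weight (w : seq nat) := foldr (fun x d => x + 2 * d) 0 w.

Definition known (w : seq nat) (S : seq (seq nat)) us :=
  lexlt (digits (size w) us) w || (us \in S).

(** Unit propagation on linear relations over F_2. *)
Definition learn w S (r : seq (seq nat)) :=
  if [seq us <- r | ~~ known w S us] is [:: us] then us :: S else S.

(* Three passes over the relations are enough for the vectors needed below. *)
Definition saturate w R S := iter 3 (fun S => foldl (learn w) S R) S.

(* The squares Sq^(2^i) generate the Steenrod algebra, so no others are used. *)
Definition hits m d K := flatten
  [seq [seq sqmon k us | us <- compositions m (d - k)]
  | k <- [seq 2 ^ i | i <- iota 0 K] & k <= d].

(** A candidate is added only when the closure of those chosen before does not reach it, which keeps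
    the result small. *)
Definition greedy w R cands :=
  foldl (fun B us => if us \in saturate w R B then B else us :: B) [::] cands.

(** Relations with a term above [w] are dropped; any sublist of the hit relations is still sound.
    The final conditions test the output of [greedy] directly. *)
Definition certified m w b :=
  let cands := [seq us <- compositions m (weight w) | digits (size w) us == w] in
  let R := [seq r <- hits m (weight w) (size w)
           | ~~ has (fun us => lexlt w (digits (size w) us)) r] in
  let B := greedy w R cands in
  [&& size B <= b, all (mem cands) B & all (mem (saturate w R B)) cands].

(** * Soundness of the computation *)

Lemma mkseqS (f : nat -> nat) K : mkseq f K.+1 = f 0 :: mkseq (f \o succn) K.
Proof. by rewrite /mkseq /= (iotaDl 1 0) -map_comp. Qed.

(** A strict comparison of truncations is decided at a position below [K], so it already compares
    the full vectors. *)
Lemma lexlt_mkseq (f g : nat -> nat) K : lexlt (mkseq f K) (mkseq g K) ->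
  exists2 i, (forall j, j < i -> f j = g j) & f i < g i.
Proof.
elim: K f g => // K IHK f g; rewrite !mkseqS /= => /orP[fg0 | /andP[/eqP fg0]].
  by exists 0.
by move=> /IHK[i eq_i lt_i]; exists i.+1 => // -[|j] // /eq_i.
Qed.

Lemma weight_mkseq (f : nat -> nat) K :
  weight (mkseq f K) = \sum_(i < K) 2 ^ i * f i.
Proof.
elim: K f => [|K IHK] f; first by rewrite big_ord0.
rewrite mkseqS big_ord_recl mul1n [LHS]/(f 0 + 2 * weight _) IHK big_distrr.
by congr (_ + _); apply: eq_bigr => i _; rewrite /= expnS mulnA.
Qed.

Section Certificate.
Variables (n : nat) (p : pvec) (K : nat).
Hypothesis pK : pdeg p < 2 ^ K.
Local Notation m := n.+1.
Local Notation w := (mkseq p K).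

Let weight_w : weight w = pdeg p.
Proof. by rewrite weight_mkseq (pdeg_sum pK). Qed.

Let size_comp us : us \in compositions m (pdeg p) -> size us = m.
Proof. by rewrite mem_compositions => /andP[/eqP]. Qed.

Let mdeg_comp us : us \in compositions m (pdeg p) -> mdeg (mon m us) = pdeg p.
Proof.
by rewrite mem_compositions => /andP[/eqP us_m /eqP <-]; rewrite mdeg_mon.
Qed.

Let digits_mon us : us \in compositions m (pdeg p) ->
  digits K us = mkseq (mparam (mon m us)) K.
Proof.
by move=> /size_comp us_m; apply: eq_mkseq => i; rewrite mparam_mon.
Qed.

Section Closure.
Variable s : seq 'X_{1..m}.

Definition sound (S : seq (seq nat)) := forall us,
  us \in S -> us \in compositions m (pdeg p) -> spanned p s 'X_[mon m us]%R.

Definition relation (r : seq (seq nat)) :=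
  {subset r <= compositions m (pdeg p)} /\
  spanned p s (\sum_(us <- r) 'X_[mon m us])%R.

Lemma spanned_known S us : sound S -> us \in compositions m (pdeg p) ->
  known w S us -> spanned p s 'X_[mon m us]%R.
Proof.
move=> Ssound us_d /orP[|/Ssound]; last exact.
rewrite size_mkseq digits_mon // => /lexlt_mkseq lt_us.
exact: spanned_lt (mdeg_comp us_d) lt_us.
Qed.

Lemma sound_learn S r : sound S -> relation r -> sound (learn w S r).
Proof.
move=> Ssound [r_d]; rewrite /learn (bigID (known w S)) /= -[X in (_ + X)%R]big_filter.
case: [seq _ <- _ | _] => [|us [|//]] // r_span vs.
rewrite inE => /predU1P[-> _|]; last exact: Ssound.
rewrite big_seq1 in r_span.
(* The single unknown term is the whole relation minus its known terms. *)
rewrite -[X in spanned _ _ X](addKr (\sum_(us <- r | known w S us) 'X_[mon m us])%R).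
apply: spannedD r_span; apply: spannedN; rewrite big_seq_cond.
apply: (big_ind (spanned p s)); [exact: spanned0 | exact: spannedD |].
by move=> {}vs /andP[/r_d]; apply: spanned_known.
Qed.

Lemma sound_saturate S R :
  sound S -> {in R, forall r, relation r} -> sound (saturate w R S).
Proof.
move=> Ssound RP; rewrite /saturate; elim: 3 => //= k.
elim: R (iter _ _ _) RP => //= r R IHR T RP Tsound.
apply: IHR; first by move=> r' r'R; apply: RP; rewrite inE r'R orbT.
by apply: sound_learn => //; apply: RP; rewrite mem_head.
Qed.

(** Since [k = 2 ^ i] is positive, the one-letter word [[:: k]] witnesses that the sum is hit. *)
Lemma relation_hits r : r \in hits m (pdeg p) K -> relation r.
Proof.
case/flatten_mapP => k; rewrite mem_filter => /andP[kd /mapP[i _ ki]].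
have k_gt0 : 0 < k by rewrite ki expn_gt0.
case/mapP=> us us_d ->.
move: us_d; rewrite mem_compositions => /andP[/eqP us_m /eqP us_d].
have sub : {subset sqmon k us <= compositions m (pdeg p)}.
  by move=> vs /sqmon_compositions; rewrite us_m us_d subnK.
split=> //; apply: spanned_hit; last first.
  rewrite -sq_mon //; exists [:: ([:: k], 'X_[mon m us]%R)]; last by rewrite big_seq1.
  by move=> x; rewrite inE => /eqP-> /=; rewrite addn0.
rewrite big_seq; apply: rpred_sum => vs /sub vs_d.
by rewrite dhomogX; apply/eqP/mdeg_comp.
Qed.

End Closure.

Lemma dim_Qparam_certified b : certified m w b -> \dim {: Qparam n p} <= b.
Proof.
rewrite /certified weight_w size_mkseq => /and3P[].
set cands := [seq _ <- compositions _ _ | _]; set R := [seq _ <- hits _ _ _ | _].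
set B := greedy _ _ _ => Bb /allP Bc /allP cS.
(* By [pK] all digits from position [K] on vanish, so agreement of the first [K] entries
   suffices. *)
have candsP us : us \in cands -> us \in compositions m (pdeg p) /\ mparam (mon m us) = p.
  rewrite mem_filter => /andP[/eqP us_w us_d]; split=> //.
  apply: (mparam_eq pK (mdeg_comp us_d)) => i iK.
  by rewrite -(nth_mkseq 0 (mparam _) iK) -digits_mon // us_w nth_mkseq.
apply: leq_trans Bb; rewrite -(size_map (mon m)); apply: dim_Qparam_le => X Xd Xp.
have [us us_m XE] := mon_surj X; rewrite XE in Xd Xp *.
have us_d : us \in compositions m (pdeg p).
  by rewrite mem_compositions us_m -Xd mdeg_mon // !eqxx.
apply: (@sound_saturate _ B R) (us_d); last first.
- by apply: cS; rewrite mem_filter us_d digits_mon // Xp eqxx.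
- by move=> r; rewrite mem_filter => /andP[_ /relation_hits].
- move=> vs vsB vs_d; have [_ vs_p] := candsP _ (Bc _ vsB).
  by apply: spanned_mem (mdeg_comp vs_d) vs_p _; apply: map_f.
Qed.

End Certificate.

(** * Enumeration of small parameter vectors and numerical estimates *)

Definition small_vectors d :=
  flatten [seq [seq w <- compositions 4 e | weight w <= d] | e <- iota 0 d.+1].

(** Each entry has weight at least 1 in the degree, so the sum of the entries is at most [d]. *)
Lemma mem_small_vectors p d : pdeg p <= d -> d < 2 ^ 4 ->
  mkseq p 4 \in small_vectors d.
Proof.
move=> pd d16; have pK := leq_ltn_trans pd d16.
have p_le : sumn (mkseq p 4) <= d.
  apply: leq_trans pd; rewrite (pdeg_sum pK) sumnE big_map -[iota 0 4]/(index_iota 0 4).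
  by rewrite big_mkord; apply: leq_sum => i _; rewrite leq_pmull // expn_gt0.
apply/flatten_mapP; exists (sumn (mkseq p 4)); first by rewrite mem_iota.
by rewrite mem_filter weight_mkseq -(pdeg_sum pK) pd mem_compositions !eqxx.
Qed.

Definition binprod m w := foldr (fun k => muln 'C(m, k)) 1 w.

Lemma binprod_mkseq m (f : nat -> nat) K :
  binprod m (mkseq f K) = \prod_(i < K) 'C(m, f i).
Proof.
elim: K f => [|K IHK] f; first by rewrite big_ord0.
by rewrite mkseqS big_ord_recl [LHS]/('C(_, _) * binprod _ _) IHK.
Qed.

(* The conditional, unlike [||], keeps [vm_compute] from evaluating the
   certificate when the binomial bound suffices. *)
Definition bounded m b :=
  all (fun w => if binprod m w <= b then true else certified m w b)
    (small_vectors 12).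

Lemma dim_Qparam_bounded n p b :
  bounded n.+1 b -> pdeg p <= 12 -> \dim {: Qparam n p} <= b.
Proof.
move=> /allP ok hp; have pK : pdeg p < 2 ^ 4 by apply: leq_ltn_trans hp _.
move: (ok _ (mem_small_vectors hp isT)); case: ifP => [+ _|_].
  by rewrite binprod_mkseq; apply/leq_trans/dim_Qparam_bin.
exact: dim_Qparam_certified.
Qed.

Lemma bin_leq_exp2 m k : 'C(m, k) <= 2 ^ m.
Proof.
rewrite -[m in 'C(m, _)]card_ord -card_draws.
apply: leq_trans (max_card _) _.
by rewrite -cardsT -powersetT card_powerset cardsT card_ord.
Qed.

(** Each factor satisfies 2^j - 1 >= 2^(j-1), and the exponents 0, ..., m-1 add up to ['C(m, 2)]. *)
Lemma prod_pow2_pred_ge m : 2 ^ 'C(m, 2) <= \prod_(1 <= j < m.+1) (2 ^ j - 1).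
Proof.
elim: m => [|m IHm]; first by rewrite big_nil.
rewrite big_nat_recr //= binS bin1 expnD leq_mul // expnS mul2n -addnn.
by rewrite -addnBA ?leq_addr // expn_gt0.
Qed.

(** This form of the product computes, so it is convertible with the numerals 1, 3, 21 and 315
    below. *)
Lemma prod_foldr (f : nat -> nat) a b :
  \prod_(a <= j < b) f j = foldr (fun j => muln (f j)) 1 (index_iota a b).
Proof. by elim: (index_iota a b) => [|j r IHr]; rewrite ?big_nil // big_cons IHr. Qed.

Lemma bounded1 : bounded 1 1. Proof. by vm_compute. Qed.
Lemma bounded2 : bounded 2 3. Proof. by vm_compute. Qed.
Lemma bounded3 : bounded 3 21. Proof. by vm_compute. Qed.
Lemma bounded4 : bounded 4 315. Proof. by vm_compute. Qed.
(** From here on the bound is a power of two below the product; 2^10 and 2^15 are 2^C(5,2) and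
    2^C(6,2). For 7 and 8 variables 2^15 still suffices and keeps the unary numeral small. *)
Lemma bounded5 : bounded 5 (2 ^ 10). Proof. by vm_compute. Qed.
Lemma bounded6 : bounded 6 (2 ^ 15). Proof. by vm_compute. Qed.
Lemma bounded7 : bounded 7 (2 ^ 15). Proof. by vm_compute. Qed.
Lemma bounded8 : bounded 8 (2 ^ 15). Proof. by vm_compute. Qed.

Theorem theorem2p9 (n : nat) (p : pvec) (hp : pdeg p <= 12) :
  \dim {: Qparam n p} <= \prod_(1 <= j < n.+2) (2 ^ j - 1).
Proof.
(* Four binomials multiply to at most 2^(4(n+1)), and 4(n+1) <= C(n+1,2) holds exactly from [n = 8]
   on. *)
case: (ltnP n 8) => [n8 | n8].
  case: n n8 => [|[|[|[|[|[|[|[|//]]]]]]]] _.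
  - by rewrite prod_foldr; apply: dim_Qparam_bounded bounded1 hp.
  - by rewrite prod_foldr; apply: dim_Qparam_bounded bounded2 hp.
  - by rewrite prod_foldr; apply: dim_Qparam_bounded bounded3 hp.
  - by rewrite prod_foldr; apply: dim_Qparam_bounded bounded4 hp.
  - exact: leq_trans (dim_Qparam_bounded bounded5 hp) (prod_pow2_pred_ge 5).
  - exact: leq_trans (dim_Qparam_bounded bounded6 hp) (prod_pow2_pred_ge 6).
  - apply: leq_trans (leq_trans (dim_Qparam_bounded bounded7 hp) _) (prod_pow2_pred_ge 7).
    by rewrite leq_exp2l.
  - apply: leq_trans (leq_trans (dim_Qparam_bounded bounded8 hp) _) (prod_pow2_pred_ge 8).
    by rewrite leq_exp2l.
apply: leq_trans (prod_pow2_pred_ge n.+1).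
apply: leq_trans (dim_Qparam_bin (K := 4) _ _) _; first exact: leq_ltn_trans hp _.
apply: (@leq_trans (\prod_(i < 4) 2 ^ n.+1)).
  by apply: leq_prod => i _; apply: bin_leq_exp2.
rewrite prod_nat_const card_ord -expnM leq_exp2l //.
by rewrite bin2 -divn2 leq_divRL //=; nia.
Qed.
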